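(* A static assignment policy gives an $O(\log k/\log\log k)$-approximation for the linear relaxation of the soft-capacitated robust facility location problem. That is, there is an absolute constant $A>0$ such that for every instance $(\mathcal F,\mathcal C,d,c,k)$ with $k\ge 3$, the optimal value of (Static-SCRFL) is at most $A\cdot\frac{\log k}{\log\log k}$ times the optimal value of (LP-SCRFL).
   Context: An instance consists of a nonempty finite set $\mathcal F$ of $n$ facilities and a finite set $\mathcal C$ of $m$ clients in a common metric space with distance $d$ ($d_{ij}$ is the distance between $i$ and $j$), a cost $c_i\ge 0$ per unit of supply at each $i\in\mathcal F$, and an integer $k\ge 1$. The set of scenarios $\mathcal C^k$ is the family of all subsets of $\mathcal C$ of size at most $k$. The soft-capacitated robust facility location problem (SCRFL) is $$\min\ \sum_{i\in\mathcal F}c_ix_i+\max_{S\in\mathcal C^k}\sum_{i\in\mathcal F}\sum_{j\in S}d_{ij}y^S_{ij}$$ subject to $\sum_{i\in\mathcal F}y^S_{ij}\ge 1$ for all $S\in\mathcal C^k$, $j\in S$; $x_i\ge\sum_{j\in S}y^S_{ij}$ for all $i\in\mathcal F$, $S\in\mathcal C^k$; $x_i$ a nonnegative integer and $y^S_{ij}\ge 0$ for all $i\in\mathcal F$, $S\in\mathcal C^k$, $j\in S$. Its linear relaxation (LP-SCRFL) is obtained by replacing the integrality of $x_i$ with $x_i\ge 0$ for every $i\in\mathcal F$. A static assignment policy is a choice of second-stage variables that do not depend on the scenario: there are $y_{ij}\ge 0$ for $i\in\mathcal F$, $j\in\mathcal C$ with $y^S_{ij}=y_{ij}$ for all $S\in\mathcal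 C^k$, $i\in\mathcal F$, $j\in S$. The problem (Static-SCRFL) is (LP-SCRFL) restricted to static assignment policies, i.e. $$\min\ \sum_{i\in\mathcal F}c_ix_i+\max_{S\in\mathcal C^k}\sum_{i\in\mathcal F}\sum_{j\in S}d_{ij}y_{ij}$$ subject to $\sum_{i\in\mathcal F}y_{ij}\ge 1$ for all $j\in\mathcal C$; $x_i\ge\max_{S\in\mathcal C^k}\sum_{j\in S}y_{ij}$ for all $i\in\mathcal F$; $x_i\ge 0$, $y_{ij}\ge 0$ for all $i\in\mathcal F$, $j\in\mathcal C$. Here $\log$ is the natural logarithm. *)

(* Defs.v *)
From HB Require Import structures.
From mathcomp Require Import all_boot all_order all_algebra.
From mathcomp Require Import all_classical all_reals all_analysis.

Set Implicit Arguments.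
Unset Strict Implicit.
Unset Printing Implicit Defensive.

Import Order.TTheory GRing.Theory Num.Theory.
Import numFieldNormedType.Exports.

Local Open Scope classical_set_scope.
Local Open Scope ring_scope.

(* Facilities and clients are index types with a location in the metric space;
   the location maps need not be injective and their ranges may overlap. *)
Record instance (R : realType) := Instance {
  space : metricType R ;
  facility : finType ;
  client : finType ;
  floc : facility -> space ;
  cloc : client -> space ;
  cost : facility -> R ;
  budget : nat ;
  facility_gt0 : (0 < #|{: facility}|)%N ;
  cost_ge0 : forall i, 0 <= cost i ;
  budget_gt0 : (0 < budget)%N }.

Section Programs.
Context {R : realType} (I : instance R).
Local Notation F := (facility I).
Local Notation C := (client I).

Definition dist (i : F) (j : C) : R := mdist (floc i) (cloc j).

Definition scenario (S : {set C}) : bool := (#|S| <= budget I)%N.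

(* Starting the maximum at 0 is harmless: the empty set is a scenario, and all
   the quantities f maximized below vanish on it. *)
Definition max_scenario (f : {set C} -> R) : R :=
  \big[Num.max/0]_(S : {set C} | scenario S) f S.

(* y S i j is only meaningful when S is a scenario and j \in S; its other
   values are neither constrained nor used. *)
Definition LP_feasible (x : F -> R) (y : {set C} -> F -> C -> R) : Prop :=
  [/\ forall S j, scenario S -> j \in S -> 1 <= \sum_i y S i j,
      forall i S, scenario S -> \sum_(j in S) y S i j <= x i,
      forall i, 0 <= x i &
      forall i S j, scenario S -> j \in S -> 0 <= y S i j].

Definition LP_objective (x : F -> R) (y : {set C} -> F -> C -> R) : R :=
  \sum_i cost i * x i +
  max_scenario (fun S => \sum_i \sum_(j in S) dist i j * y S i j).

Definition LP_values : set R :=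
  [set v | exists x y, LP_feasible x y /\ v = LP_objective x y].

Definition LP_opt : R := inf LP_values.

Definition static_feasible (x : F -> R) (y : F -> C -> R) : Prop :=
  [/\ forall j, 1 <= \sum_i y i j,
      forall i, max_scenario (fun S => \sum_(j in S) y i j) <= x i,
      forall i, 0 <= x i &
      forall i j, 0 <= y i j].

Definition static_objective (x : F -> R) (y : F -> C -> R) : R :=
  \sum_i cost i * x i +
  max_scenario (fun S => \sum_i \sum_(j in S) dist i j * y i j).

Definition static_values : set R :=
  [set v | exists x y, static_feasible x y /\ v = static_objective x y].

Definition static_opt : R := inf static_values.

Lemma max_scenario_ge0 f : 0 <= max_scenario f.
Proof.
rewrite /max_scenario; elim/big_rec: _ => // S v _ v0.
by rewrite le_max v0 orbT.
Qed.

Lemma max_scenario_le f v : 0 <= v ->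
  max_scenario f <= v <-> forall S, scenario S -> f S <= v.
Proof.
move=> v0; split=> [fv S sS|fv].
  by apply: le_trans fv; rewrite /max_scenario (bigD1 S)//= le_max lexx.
by apply/bigmax_leP; split.
Qed.

(* The static program is the linear relaxation restricted to the policies
   that do not depend on the scenario. *)
Lemma static_feasibleE x y : (forall i j, 0 <= y i j) ->
  static_feasible x y <-> LP_feasible x (fun=> y).
Proof.
move=> y0; split=> [[y1 yx x0 _]|[y1 yx x0 _]]; split=> //.
- by move=> i S sS; have /(max_scenario_le _ (x0 i)) := yx i; exact.
- move=> j; apply: (y1 [set j]%SET); last by rewrite inE.
  by rewrite /scenario cards1 budget_gt0.
- by move=> i; apply/max_scenario_le => // S; exact: yx.
Qed.

Lemma static_objectiveE x y : static_objective x y = LP_objective x (fun=> y).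
Proof. by []. Qed.

Lemma LP_objective_ge0 x y : LP_feasible x y -> 0 <= LP_objective x y.
Proof.
move=> [_ _ x0 _]; apply: addr_ge0; last exact: max_scenario_ge0.
by apply: sumr_ge0 => i _; rewrite mulr_ge0 ?cost_ge0.
Qed.

Lemma static_nonempty : static_values !=set0.
Proof.
pose y (i : F) (j : C) : R := 1; pose x (i : F) : R := #|C|%:R.
exists (static_objective x y), x, y; split => //.
have /card_gt0P[i0 _] := facility_gt0 I.
split=> [j|i|i|i j]; rewrite /x /y ?ler0n ?ler01//.
  by rewrite (bigD1 i0)//= lerDl sumr_ge0.
apply/max_scenario_le => // S _; rewrite sumr_const ler_nat.
exact: max_card.
Qed.

(* Both infima are taken over nonempty sets that are bounded below. *)
Lemma has_inf_static_values : has_inf static_values.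
Proof.
split; first exact: static_nonempty.
exists 0 => _ [x [y [[y1 yx x0 y0] ->]]]; rewrite static_objectiveE.
by apply: LP_objective_ge0; apply/static_feasibleE.
Qed.

Lemma has_inf_LP_values : has_inf LP_values.
Proof.
split; last by exists 0 => _ [x [y [xy ->]]]; exact: LP_objective_ge0.
have [_ [x [y [xy _]]]] := static_nonempty.
exists (LP_objective x (fun=> y)), x, (fun=> y); split => //.
by apply/static_feasibleE => //; case: xy.
Qed.

End Programs.

(* Main.v *)
(* Fix a solution [x, y] of the linear relaxation whose second-stage cost is at
   most [z], a radius of order [z / k], and [p = O(log k / log log k)] with
   [p ^ p >= k].  A client with [k] clients within [p] radii sees at least
   [k / 2] units of supply nearby and can use each facility [i] to the extent
   [2 x_i / k], which overloads no scenario.  The remaining clients are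
   clustered by ball growing: in [p] steps of one radius a ball cannot multiply
   its population by [p] each time, so it stops at a ring whose clients can be
   charged, [p] to one, to clients of an inner ball.  Inner balls are more than
   one radius apart, so the facilities within half a radius of them are
   disjoint.  Inner balls with enough supply nearby use it proportionally.  A
   scenario composed of the other inner balls has at most [k / 4] clients,
   since half of its clients are served from at least half a radius away at
   total cost at most [z].  Adding these balls one at a time, all of them
   together form one scenario, whose own assignment [y] serves them. *)
Require Import Defs.
From mathcomp Require Import all_boot all_order all_algebra.
From mathcomp Require Import all_classical all_reals all_analysis.
From mathcomp Require Import zify ring lra.
Import Order.TTheory GRing.Theory Num.Theory.
Local Open Scope ring_scope.

(** * Ball growing and representatives of sparse clients *)

(** Cut an enumeration of [A] into blocks of [q] positions and send each block to one element of
    [B]. *)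
Lemma bounded_fibers (C : finType) (A B : {set C}) (q : nat) :
  (0 < q)%N -> (#|A| <= q * #|B|)%N ->
  exists e : C -> C, (forall j, j \in A -> e j \in B) /\
    forall b, (#|[set j in A | e j == b]%SET| <= q)%N.
Proof.
move=> q0 AB.
have ltB j : j \in A -> (index j (enum A) %/ q < #|B|)%N.
  move=> jA; rewrite ltn_divLR// mulnC; apply: leq_trans AB.
  by rewrite cardE index_mem mem_enum.
exists (fun j => nth j (enum B) (index j (enum A) %/ q)); split.
  by move=> j jA; rewrite -mem_enum mem_nth// -cardE ltB.
move=> b; set D := finset _.
pose r j : 'I_q := Ordinal (ltn_pmod (index j (enum A)) q0).
rewrite -[leqRHS]card_ord; apply: (@leq_card_in _ _ r) => j j'.
rewrite !inE => /andP[jA /eqP ej] /andP[j'A /eqP ej'] [rjj'].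
have dE : (index j (enum A) %/ q = index j' (enum A) %/ q)%N.
  apply/eqP; rewrite -(nth_uniq j _ _ (enum_uniq B)) -?cardE ?ltB//.
  by rewrite ej -ej'; apply/eqP/set_nth_default; rewrite -cardE ltB.
apply: (@index_inj _ j (enum A)); rewrite ?inE ?mem_enum//.
by rewrite (divn_eq (index j _) q) (divn_eq (index j' _) q) dE rjj'.
Qed.

(** [f] gives each client a representative, and [h] gives each representative the center of its
    ball. Balls are carved off around arbitrary remaining clients: the outer ball [N t.+1] is
    removed and represented inside [N t], so all later representatives are more than [D] away from
    these. *)
Lemma sparse_clustering (R : realDomainType) (C : finType) (d : C -> C -> R)
    (D : R) (p k : nat) (P : {set C}) :
  (forall a, d a a = 0) -> (forall a b, d a b = d b a) ->
  (forall a b c, d a c <= d a b + d b c) ->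
  0 <= D -> (0 < p)%N -> (k <= p ^ p)%N ->
  (forall c, c \in P -> (#|[set j in P | (d c j <= p%:R * D)%R]%SET| < k)%N) ->
  exists f h : C -> C,
    [/\ forall j, j \in P -> [/\ f j \in P, h (f j) \in P,
          d (h (f j)) j <= p%:R * D & d (h (f j)) (f j) <= p%:R * D],
        forall a, (#|[set j in P | f j == a]%SET| <= p)%N &
        forall j j', j \in P -> j' \in P -> h (f j) != h (f j') ->
          D < d (f j) (f j')].
Proof.
move=> d0 dC dT D0 p0 kp.
have [n] := ubnP #|P|; elim: n P => // n IH P Pn Pk.
have [->|[c cP]] := set_0Vmem P.
  exists id, id; split=> [j|a|j j']; rewrite ?inE//.
  by rewrite (eq_card0 (A := [set _ in _ | _]%SET))// => j; rewrite !inE.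
pose N t := [set j in P | (d c j <= t%:R * D)%R]%SET.
have [t tp Nt] : exists2 t, (t < p)%N & (#|N t.+1| <= p * #|N t|)%N.
  (* Otherwise [p] growth steps would put at least [p ^ p >= k] clients of [P] within [p * D] of
     [c]. *)
  apply: contrapT => Nex.
  suff : forall t, (t <= p)%N -> (p ^ t <= #|N t|)%N.
    by move=> /(_ p (leqnn p)); have := Pk c cP; rewrite -/(N p); lia.
  elim=> [_|t IHt tp].
    by rewrite expn0; apply/card_gt0P; exists c; rewrite inE cP d0 mul0r lexx.
  have /negP : ~ (#|N t.+1| <= p * #|N t|)%N by move=> ?; apply: Nex; exists t.
  rewrite -ltnNge => /ltnW; apply: leq_trans.
  by rewrite expnS leq_mul2l IHt ?orbT// ltnW.
have [e [eN efib]] := @bounded_fibers C _ _ _ p0 Nt.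
have NP s j : j \in N s -> j \in P by rewrite inE => /andP[].
have NS : {subset N t <= N t.+1}.
  move=> j; rewrite !inE => /andP[-> /le_trans]; apply.
  by rewrite ler_wpM2r// ler_nat.
have Np s j : (s <= p)%N -> j \in N s -> d c j <= p%:R * D.
  rewrite inE => sp /andP[_ /le_trans]; apply.
  by rewrite ler_wpM2r// ler_nat.
have cN : c \in N t.+1 by rewrite inE cP d0 mulr_ge0.
have [||f' [h' [f'P f'fib sep]]] := IH (P :\: N t.+1)%SET.
- apply: leq_trans (_ : #|P| <= n)%N; last by rewrite -ltnS.
  apply/proper_card/properP; split; first exact: subsetDl.
  by exists c => //; rewrite inE cN.
- move=> a /setDP[aP _]; apply: leq_ltn_trans (Pk a aP).
  apply/subset_leq_card/fintype.subsetP => j; rewrite !inE.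
  by case/andP => /andP[_ ->] ->.
pose f j := if j \in N t.+1 then e j else f' j.
pose h a := if a \in N t then c else h' a.
have fout j : j \in P -> j \notin N t.+1 -> f j \in (P :\: N t.+1)%SET.
  move=> jP jN; rewrite /f (negbTE jN).
  by have [|] := f'P j; rewrite // inE jN.
(* Later representatives avoid [N t], so resetting [h] there does not affect them. *)
have hout a : a \in (P :\: N t.+1)%SET -> h a = h' a.
  case/setDP => _ aN; rewrite /h ifN//.
  by apply: contra aN; exact: NS.
have far a b : a \in N t -> b \in (P :\: N t.+1)%SET -> D < d a b.
  rewrite inE => /andP[_ ca] /setDP[bP]; rewrite inE bP/= -ltNge => cb.
  have := dT c a b; move: ca cb; rewrite -natr1 mulrDl mul1r; lra.
exists f, h; split.
- move=> j jP; case: (boolP (j \in N t.+1)) => jN.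
    have eNj := eN _ jN.
    rewrite /f jN /h eNj; split => //; [exact: NP eNj|exact: Np jN|].
    exact: Np (ltnW tp) eNj.
  have fo := fout _ jP jN; rewrite hout//.
  move: fo; rewrite /f (negbTE jN) => fo.
  have [|_] := f'P j; first by rewrite inE jN.
  by case/setDP=> hP _ *; split => //; case/setDP: fo.
- move=> a; case: (boolP (a \in N t)) => aN.
    apply: leq_trans (efib a); apply/subset_leq_card/fintype.subsetP => j.
    rewrite finset.in_set => /andP[jP]; rewrite finset.in_set.
    case: (boolP (j \in N t.+1)) => jN.
      by rewrite /f jN => ->.
    move=> /eqP fa; have := fout _ jP jN.
    by rewrite fa => /setDP[_]; rewrite (NS _ aN).
  apply: leq_trans (f'fib a); apply/subset_leq_card/fintype.subsetP => j.
  rewrite finset.in_set => /andP[jP]; rewrite finset.in_set.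
  case: (boolP (j \in N t.+1)) => jN.
    by rewrite /f jN => /eqP ea; move: aN; rewrite -ea eN.
  by rewrite /f (negbTE jN) => fa; rewrite fa andbT inE jN.
- move=> j j' jP j'P.
  case: (boolP (j \in N t.+1)) => jN; case: (boolP (j' \in N t.+1)) => j'N.
  + by rewrite /f jN j'N /h !eN// eqxx.
  + move=> _; apply: far (fout _ j'P j'N); by rewrite /f jN eN.
  + move=> _; rewrite dC; apply: far (fout _ jP jN); by rewrite /f j'N eN.
  + rewrite !hout ?fout// /f (negbTE jN) (negbTE j'N); apply: sep.
      by rewrite inE jN.
    by rewrite inE j'N.
Qed.

(** * Local supply in a fixed fractional solution *)

Section Rounding.
Context {R : realType} (I : instance R).
Local Notation F := (facility I).
Local Notation C := (client I).
Local Notation k := (budget I).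

Context (x : F -> R) (y : {set C} -> F -> C -> R) (z : R).
Context (xy : LP_feasible x y) (z_gt0 : 0 < z).
Context (le_z : forall S, scenario S ->
  \sum_i \sum_(j in S) dist i j * y S i j <= z).

(* Any [k / 8] clients served from distance at least [radius / 2] already cost
   [z]. *)
Let radius : R := 16 * z / k%:R.

Let cdist (a b : C) : R := mdist (cloc a) (cloc b).

Let mass (U : {set F}) : R := \sum_(i in U) x i.

(** Half a radius makes these sets disjoint for client sets more than one radius apart. *)
Let near (S : {set C}) : {set F} :=
  [set i | [exists a in S, (2 * dist i a <= radius)%R]]%SET.

Let k_gt0 : 0 < k%:R :> R. Proof. by rewrite ltr0n budget_gt0. Qed.

Let radius_gt0 : 0 < radius.
Proof. by rewrite /radius !mulr_gt0// invr_gt0. Qed.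

Let x_ge0 i : 0 <= x i. Proof. by case: xy. Qed.

Let y_ge0 S i j : scenario S -> j \in S -> 0 <= y S i j.
Proof. by case: xy => _ _ _; exact. Qed.

Let y_le S i (A : {set C}) : scenario S -> A \subset S ->
  \sum_(j in A) y S i j <= x i.
Proof.
move=> sS AS; case: xy => _ /(_ i S sS) h _ _; apply: le_trans h.
rewrite [leRHS](big_setID A)/= (finset.setIidPr AS) lerDl.
by apply: sumr_ge0 => j /setDP[jS _]; exact: y_ge0 sS jS.
Qed.

Let dist_ge0 i (j : C) : 0 <= dist i j. Proof. exact: mdist_ge0. Qed.

Let dist_le i (a b : C) : dist i b <= dist i a + cdist a b.
Proof. exact: metric_triangle. Qed.

Let mass_ge0 U : 0 <= mass U. Proof. exact: sumr_ge0. Qed.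

(* Serving a client from outside its set [U j] costs at least [radius / 2]
   per unit. *)
Lemma mostly_local S (U : C -> {set F}) : scenario S ->
  (forall i j, j \in S -> i \notin U j -> radius <= 2 * dist i j) ->
  #|S|%:R - k%:R / 8 <= \sum_(j in S) \sum_(i in U j) y S i j.
Proof.
move=> sS far.
pose out := \sum_(j in S) \sum_(i in ~: U j) y S i j.
have cover : #|S|%:R <= \sum_(j in S) \sum_(i in U j) y S i j + out.
  rewrite -sumr_const -big_split/=; apply: ler_sum => j jS.
  case: xy => /(_ S j sS jS) + _ _ _; congr (_ <= _).
  rewrite (bigID (mem (U j)))/=; congr (_ + _).
  by apply: eq_bigl => i; rewrite inE.
have : out * radius <= 2 * z.
  have := le_z _ sS; rewrite -(ler_pM2l (_ : 0 < 2 :> R))//; apply: le_trans.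
  rewrite exchange_big mulr_suml mulr_sumr; apply: ler_sum => j jS.
  rewrite [leRHS]mulr_sumr mulr_suml [leRHS](bigID (mem (U j)))/=.
  apply: ler_wpDl.
    by apply: sumr_ge0 => i _; rewrite !mulr_ge0// y_ge0.
  rewrite [leLHS](eq_bigl (fun i => i \notin U j)); last first.
    by move=> i; rewrite inE.
  apply: ler_sum => i iU; rewrite mulrC mulrA ler_wpM2r ?y_ge0//.
  exact: far.
rewrite /radius mulrA ler_pdivrMr//.
have := z_gt0; move: cover k_gt0; set o := out; nra.
Qed.

(** At most [k / 8] units for [S] come from outside [near S], and a facility inside gives the
    scenario at most [x i]. *)
Lemma mass_near S : scenario S -> #|S|%:R - k%:R / 8 <= mass (near S).
Proof.
move=> sS; apply: le_trans (_ : _ <= \sum_(j in S) \sum_(i in near S) y S i j) _.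
  apply: (mostly_local S (fun=> near S)) => // i j jS.
  rewrite inE negb_exists => /forallP/(_ j).
  by rewrite jS/= -ltNge => /ltW.
by rewrite exchange_big; apply: ler_sum => i _; exact: y_le.
Qed.

(** Any [k] clients around [c] form a scenario with at least [k / 2] units of supply near it.
    Spreading [c] proportionally over that supply is thin enough for [k] such clients to load [i] by
    at most [2 * x i]. *)
Lemma thin_policy (t : R) (c : C) :
  (k <= #|[set j | (cdist c j <= t)%R]%SET|)%N -> 0 <= t ->
  exists w : F -> R,
    [/\ forall i, 0 <= w i <= 2 * x i / k%:R, \sum_i w i = 1 &
        \sum_i dist i c * w i <= t + radius].
Proof.
move=> kB t0.
have [S SB Sk] : exists2 S : {set C},
    S \subset [set j | (cdist c j <= t)%R]%SET & #|S| = k.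
  have /card_geqP[s [us ss sB]] := kB.
  exists [set j in s]%SET.
    by apply/fintype.subsetP => j; rewrite inE => /sB.
  by rewrite cardsE (card_uniqP us).
have mS : k%:R / 2 <= mass (near S).
  have := mass_near; move/(_ S); rewrite /scenario Sk leqnn => /(_ isT).
  move: k_gt0; lra.
have m0 : 0 < mass (near S) by apply: lt_le_trans mS; rewrite divr_gt0.
exists (fun i => if i \in near S then x i / mass (near S) else 0).
have w0 i : 0 <= (if i \in near S then x i / mass (near S) else 0).
  by case: ifP => // _; rewrite divr_ge0.
have w1 : \sum_i (if i \in near S then x i / mass (near S) else 0) = 1.
  by rewrite -big_mkcond/= -mulr_suml divff// gt_eqF.
split=> //.
  move=> i; rewrite w0/=; case: ifP => _; last by rewrite divr_ge0 ?mulr_ge0.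
  rewrite ler_pdivrMr// mulrAC ler_pdivlMr//.
  by have := x_ge0 i; move: mS; move: (mass _) => m; nra.
rewrite -[leRHS]mulr1 -w1 mulr_sumr; apply: ler_sum => i _.
case: ifPn => [iS|_]; last by rewrite !mulr0.
apply: ler_wpM2r; first by rewrite divr_ge0.
move: iS; rewrite inE => /existsP[a /andP[aS ia]].
have := dist_le i a c; rewrite [cdist a c]metric_sym.
have := fintype.subsetP SB _ aS; rewrite inE /cdist => ca.
have := radius_gt0; lra.
Qed.

(** * Serving the representatives, cluster by cluster *)

Section Clusters.
Context (Q : {set C}) (h : C -> C) (t : R).
Context (center : forall a, a \in Q -> cdist (h a) a <= t).
Context (separated : forall a b, a \in Q -> b \in Q -> h a != h b ->
  radius < cdist a b).
Let cluster (c : C) : {set C} := [set a in Q | h a == c]%SET.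
Context (cluster_le : forall c, (#|cluster c| <= k)%N).

Let starved (a : C) : bool :=
  (2 * mass (near (cluster (h a))) < #|cluster (h a)|%:R)%R.

(** All but [k / 8] units for [S] must come from near the clusters of its clients, but starved
    clusters offer at most half a unit per client. So [#|S| - k / 8 <= #|S| / 2]. *)
Lemma starved_small (S : {set C}) : scenario S -> S \subset Q ->
  (forall a, a \in S -> cluster (h a) \subset S) -> {in S, forall a, starved a} ->
  (4 * #|S| <= k)%N.
Proof.
move=> sS SQ sat st.
have clS a : a \in S -> a \in cluster (h a).
  by move=> aS; rewrite inE eqxx (fintype.subsetP SQ).
have low := @mostly_local S (fun a => near (cluster (h a))) sS.
have {}low : #|S|%:R - k%:R / 8 <=
    \sum_(a in S) \sum_(i in near (cluster (h a))) y S i a.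
  apply: low => i a aS; rewrite inE negb_exists => /forallP/(_ a).
  by rewrite clS//= -ltNge => /ltW.
have up : \sum_(a in S) \sum_(i in near (cluster (h a))) y S i a <=
    \sum_(a in S) (1 / 2).
  rewrite (partition_big h predT)//= [leRHS](partition_big h predT)//=.
  apply: ler_sum => c _.
  have [/existsP[a /andP[aS /eqP ac]]|nc] :=
      boolP [exists a, (a \in S) && (h a == c)]; last first.
    by rewrite !big_pred0// => a; apply: contraNF nc => ac;
       apply/existsP; exists a.
  (* [S] contains whole clusters, so its part with center [c] is all of [cluster c]. *)
  have SE b : (b \in S) && (h b == c) = (b \in cluster c).
    rewrite inE; apply/andP/andP => -[bS bc].
      by rewrite (fintype.subsetP SQ).
    split=> //; apply: (fintype.subsetP (sat _ aS)).
    by rewrite inE bS ac.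
  have cS : cluster c \subset S by rewrite -ac sat.
  rewrite (eq_bigl _ _ SE) [leRHS](eq_bigl _ _ SE).
  rewrite (eq_bigr (fun b => \sum_(i in near (cluster c)) y S i b)); last first.
    by move=> b; rewrite inE => /andP[_ /eqP ->].
  rewrite exchange_big sumr_const -[(_ / _) *+ _]mulr_natr.
  apply: le_trans (_ : mass (near (cluster c)) <= _).
    by apply: ler_sum => i _; exact: y_le.
  by have := st _ aS; rewrite /starved ac; lra.
have := le_trans low up.
rewrite sumr_const -[(_ / _) *+ _]mulr_natr -(ler_nat R) natrM; lra.
Qed.

(** A union of starved clusters with at most [k] clients has in fact at most [k / 4]. Adding one
    more cluster, itself at most [k / 4], therefore stays below [k], and the bound improves to
    [k / 4] again. *)
Lemma starved_le : (#|[set a in Q | starved a]%SET| <= k)%N.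
Proof.
pose B (D : {set C}) := [set a in Q | starved a && (h a \in D)]%SET.
have satB D a : a \in B D -> cluster (h a) \subset B D.
  rewrite inE => /and3P[aQ sa haD]; apply/fintype.subsetP => b.
  rewrite !inE => /andP[-> /eqP hba].
  by rewrite /starved hba/=; apply/andP.
have B_small D : (#|B D| <= k)%N -> (4 * #|B D| <= k)%N.
  move=> BD; apply: (starved_small (B D) BD).
  - by apply/fintype.subsetP => a; rewrite inE => /andP[].
  - by move=> a; exact: satB.
  - by move=> a; rewrite inE => /and3P[].
suff H D : (4 * #|B D| <= k)%N.
  apply: leq_trans (_ : #|B [set: C]%SET| <= k)%N; last first.
    by have := H [set: C]%SET; lia.
  apply/subset_leq_card/fintype.subsetP => a.
  by rewrite inE => /andP[aQ sa]; rewrite inE aQ sa inE.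
have [n] := ubnP #|D|; elim: n D => // n IH D Dn.
have [->|[c cD]] := set_0Vmem D.
  by rewrite (eq_card0 (A := B _)) ?muln0// => a; rewrite !inE !andbF.
apply/B_small.
have Bc : (4 * #|B [set c]%SET| <= k)%N.
  apply/B_small/(leq_trans _ (cluster_le c))/subset_leq_card/fintype.subsetP.
  by move=> a; rewrite !inE => /and3P[-> _ ->].
have BD' : (4 * #|B (D :\ c)%SET| <= k)%N.
  by apply: IH; move: Dn; rewrite (cardsD1 c) cD.
have : (#|B D| <= #|B [set c]%SET :|: B (D :\ c)%SET|)%N.
  apply/subset_leq_card/fintype.subsetP => a; rewrite !inE.
  by move=> /and3P[-> -> ->]; rewrite !andbT orbN.
have := leq_card_setU (B [set c]%SET) (B (D :\ c)%SET); case=> + _; lia.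
Qed.

(** The load [3 * x i] is [x i] for the starved clients, who follow their joint scenario, plus
    [2 * x i] for the only other cluster that can use [i]. [E] is the cost of the starved clients in
    that scenario. *)
Lemma cluster_policy : exists (w : F -> C -> R) (E : C -> R),
  [/\ forall i a, a \in Q -> 0 <= w i a,
      forall a, a \in Q -> \sum_i w i a = 1,
      forall i, \sum_(a in Q) w i a <= 3 * x i &
      [/\ forall a, 0 <= E a, \sum_(a in Q) E a <= z &
          forall a, a \in Q -> \sum_i dist i a * w i a <= 2 * t + radius + E a]].
Proof.
pose B := [set a in Q | starved a]%SET.
have sB : scenario B := starved_le.
pose N (a : C) := near (cluster (h a)).
(* On [B] the divisor is at least 1, so normalizing never raises [y B]. *)
pose w i a := if a \in B then y B i a / \sum_i' y B i' a
  else if i \in N a then x i / mass (N a) else 0.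
pose E a := if a \in B then \sum_i dist i a * y B i a else 0.
have yB1 a : a \in B -> 1 <= \sum_i y B i a.
  by case: xy => h1 _ _ _; exact: h1.
have clQ a : a \in Q -> a \in cluster (h a) by rewrite inE eqxx => ->.
have cl_gt0 a : a \in Q -> (0 : R) < #|cluster (h a)|%:R.
  by move=> aQ; rewrite ltr0n; apply/card_gt0P; exists a; exact: clQ.
have fed a : a \in Q -> a \notin B -> #|cluster (h a)|%:R <= 2 * mass (N a).
  by move=> aQ; rewrite inE aQ -leNgt.
have mass_gt0 a : a \in Q -> a \notin B -> 0 < mass (N a).
  by move=> aQ aB; have := cl_gt0 _ aQ; have := fed _ aQ aB; lra.
have w0 i a : a \in Q -> 0 <= w i a.
  move=> aQ; rewrite /w; case: ifPn => aB; last by case: ifP; rewrite ?divr_ge0.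
  by rewrite divr_ge0 ?y_ge0//; apply: le_trans (yB1 _ aB).
have wB i a : a \in B -> w i a <= y B i a.
  move=> aB; rewrite /w aB ler_pdivrMr; last exact: lt_le_trans (yB1 _ aB).
  by rewrite ler_peMr ?y_ge0// yB1.
have w1 a : a \in Q -> \sum_i w i a = 1.
  move=> aQ; rewrite /w; case: (boolP (a \in B)) => aB.
    by rewrite -mulr_suml divff// gt_eqF// (lt_le_trans _ (yB1 _ aB)).
  by rewrite -big_mkcond/= -mulr_suml divff// gt_eqF// mass_gt0.
exists w, E; split=> //; last first.
  split.
  - move=> a; rewrite /E; case: ifP => // aB; apply: sumr_ge0 => i _.
    by rewrite mulr_ge0 ?y_ge0.
  - apply: le_trans (le_z _ sB); rewrite exchange_big/=.
    rewrite (bigID (mem B))/= [X in _ + X <= _]big1 ?addr0; last first.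
      by move=> a /andP[_ /negbTE aB]; rewrite /E aB.
    rewrite le_eqVlt; apply/orP; left; apply/eqP.
    apply: eq_big => [a|a /andP[_ aB]]; last by rewrite /E aB.
    by rewrite inE; case: (a \in Q).
  - move=> a aQ; rewrite /E; case: ifPn => aB.
      apply: ler_wpDl; last by apply: ler_sum => i _; rewrite ler_wpM2l// wB.
      have : 0 <= t by apply: le_trans (center _ aQ); exact: mdist_ge0.
      by have := radius_gt0; lra.
    rewrite addr0 -[leRHS]mulr1 -[X in _ <= _ * X](w1 _ aQ) mulr_sumr.
    apply: ler_sum => i _.
    rewrite /w (negbTE aB); case: ifPn => [iN|_]; last by rewrite !mulr0.
    apply: ler_wpM2r; first by rewrite divr_ge0.
    move: iN; rewrite inE => /existsP[b /andP[]].
    rewrite inE => /andP[bQ /eqP hb] ib.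
    have := dist_le i b a; have := center _ aQ; have := center _ bQ.
    have := metric_triangle (cloc b) (cloc (h a)) (cloc a).
    rewrite hb /cdist [mdist (cloc (h a)) (cloc b)]metric_sym.
    by have := radius_gt0; lra.
move=> i; rewrite (bigID (mem B))/=.
have -> : 3 * x i = x i + 2 * x i by ring.
apply: lerD.
  apply: le_trans (y_le B i B sB _) => //.
  rewrite (eq_bigl (mem B)); last by move=> a; rewrite !inE; case: (a \in Q).
  by apply: ler_sum => a; exact: wB.
pose G := [pred a | [&& a \in Q, a \notin B & i \in N a]].
have -> : \sum_(a in Q | a \notin B) w i a = \sum_(a | G a) x i / mass (N a).
  rewrite [RHS](eq_bigl (fun a => [&& a \in Q, a \notin B & i \in N a]))//.
  under [RHS]eq_bigl do rewrite andbA.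
  rewrite [RHS]big_mkcondr; apply: eq_bigr => a /andP[_ /negbTE aB].
  by rewrite /w aB.
have [g /and3P[gQ gB ig]|noG] := pickP G; last first.
  by rewrite big_pred0// mulr_ge0.
(* A facility within half a radius of two clusters would contradict their separation. *)
have Gh a : G a -> h a = h g.
  move=> /and3P[aQ aB ia]; apply/eqP; apply: contraT => hag.
  move: ia ig; rewrite !inE.
  move=> /existsP[b /andP[+ ib]] /existsP[b' /andP[+ ib']].
  rewrite !inE => /andP[bQ /eqP hb] /andP[b'Q /eqP hb'].
  have := separated _ _ bQ b'Q; rewrite hb hb' => /(_ hag).
  have := metric_triangle (cloc b) (floc i) (cloc b').
  rewrite [mdist (cloc b) (floc i)]metric_sym.
  move: ib ib'; rewrite /dist /cdist; lra.
apply: le_trans (_ : \sum_(a in cluster (h g)) x i / mass (N g) <= _).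
  rewrite [leRHS](bigID G)/= -[leLHS]addr0; apply: lerD; last first.
    by apply: sumr_ge0 => a _; rewrite divr_ge0.
  rewrite le_eqVlt; apply/orP; left; apply/eqP; apply: eq_big => [a|a Ga].
    rewrite [in RHS]inE; apply/idP/andP => [Ga|[_ ->]//].
    by rewrite Ga Gh//; case/and3P: Ga => ->; rewrite eqxx.
  by rewrite /N Gh.
rewrite sumr_const -[_ *+ _]mulr_natl mulrCA mulrC ler_wpM2r//.
by rewrite ler_pdivrMr ?mass_gt0// fed.
Qed.
End Clusters.

(** * Assembling the static policy *)

(** Clients of [P] copy their representatives, at most [p] to one; the others use thin policies. The
    load is at most [3 * p + 2 <= 5 * p] times [x]. A scenario costs at most
    [5 * t * k = 80 * p * z] for distances and [p * z] for [E], hence 81. *)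
Lemma static_rounding (p : nat) : (0 < p)%N -> (k <= p ^ p)%N ->
  static_opt I <= 81 * p%:R * (\sum_i cost i * x i + z).
Proof.
move=> p0 kp; pose t := p%:R * radius.
have t0 : 0 <= t by rewrite mulr_ge0// ltW.
pose P := [set c | (#|[set j | (cdist c j <= t)%R]| < k)%N]%SET.
have [|||||||f [h [fP ffib fsep]]] := @sparse_clustering R C cdist radius p k P.
- by move=> a; exact: mdistxx.
- by move=> a b; exact: metric_sym.
- by move=> a b c; exact: metric_triangle.
- exact: ltW.
- exact: p0.
- exact: kp.
- move=> c; rewrite inE; apply: leq_ltn_trans.
  apply/subset_leq_card/fintype.subsetP => j.
  by rewrite finset.in_set => /andP[_ ?]; rewrite finset.in_set.
pose Q := (f @: P)%SET.
have fQ j : j \in P -> f j \in Q by exact: imset_f.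
have center a : a \in Q -> cdist (h a) a <= t by case/imsetP => j /fP[? ? ? ?] ->.
have separated a b : a \in Q -> b \in Q -> h a != h b -> radius < cdist a b.
  by move=> /imsetP[j jP ->] /imsetP[j' j'P ->]; exact: fsep.
(* A nonempty cluster lies within [t] of its center, which belongs to [P]. *)
have small c : (#|[set a in Q | h a == c]%SET| <= k)%N.
  have [/existsP[_ /andP[/imsetP[j jP ->] /eqP <-]]|nc] :=
    boolP [exists a, (a \in Q) && (h a == c)]; last first.
    rewrite eq_card0// => a; rewrite finset.in_set.
    by apply: contraNF nc => ac; apply/existsP; exists a.
  have [_ + _ _] := fP _ jP; rewrite [_ \in P]inE => /ltnW; apply: leq_trans.
  apply/subset_leq_card/fintype.subsetP => a.
  by rewrite finset.in_set => /andP[aQ /eqP <-]; rewrite finset.in_set center.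
have [w [E [w0 w1 wx [E0 Ez wE]]]] := cluster_policy Q h t center separated small.
have /choice[v vP] j : exists v : F -> R, j \notin P ->
    [/\ forall i, 0 <= v i <= 2 * x i / k%:R, \sum_i v i = 1 &
        \sum_i dist i j * v i <= t + radius].
  have [jP|jP] := boolP (j \in P); first by exists (fun=> 0).
  have [||v vj] := thin_policy t j => //; last by exists v.
  by move: jP; rewrite inE -leqNgt.
have by_fiber (S : {set C}) (g : C -> R) : (forall a, a \in Q -> 0 <= g a) ->
    \sum_(j in S :&: P) g (f j) <= p%:R * \sum_(a in Q) g a.
  move=> g0; apply: le_trans (_ : \sum_(j in P) g (f j) <= _).
    rewrite [leRHS](big_setID S)/= finset.setIC lerDl.
    by apply: sumr_ge0 => j /setDP[jP _]; rewrite g0// fQ.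
  rewrite (partition_big f (mem Q))//= mulr_sumr; apply: ler_sum => a aQ.
  rewrite (eq_bigr (fun=> g a)); last by move=> j /andP[_ /eqP ->].
  rewrite sumr_const -[leLHS]mulr_natl ler_wpM2r ?g0// ler_nat.
  apply: leq_trans (ffib a); apply/subset_leq_card/fintype.subsetP => j.
  by rewrite finset.in_set.
pose u i j := if j \in P then w i (f j) else v j i.
have u0 i j : 0 <= u i j.
  rewrite /u; case: ifPn => jP; first by rewrite w0// fQ.
  by have [/(_ i)/andP[]] := vP j jP.
have u1 j : \sum_i u i j = 1.
  rewrite /u; case: (boolP (j \in P)) => jP; first by rewrite w1// fQ.
  by have [] := vP j jP.
have load i (S : {set C}) : scenario S -> \sum_(j in S) u i j <= 5 * p%:R * x i.
  move=> sS; rewrite (big_setID P)/=.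
  have p1 : 1 <= p%:R :> R by rewrite ler1n.
  apply: le_trans (_ : p%:R * (3 * x i) + 2 * x i <= _); last first.
    by have := x_ge0 i; nra.
  apply: lerD.
    rewrite (eq_bigr (fun j => w i (f j))); last first.
      by move=> j; rewrite inE /u => /andP[_ ->].
    apply: le_trans (by_fiber S (w i) (w0 i)) _.
    by rewrite ler_wpM2l.
  apply: le_trans (_ : \sum_(j in S :\: P) 2 * x i / k%:R <= _).
    apply: ler_sum => j /setDP[_ jP]; rewrite /u (negbTE jP).
    by have [/(_ i)/andP[]] := vP j jP.
  rewrite sumr_const -[_ *+ _]mulr_natr mulrAC ler_pdivrMr//.
  rewrite ler_wpM2l ?mulr_ge0// ler_nat; apply: leq_trans sS.
  by apply/subset_leq_card/fintype.subsetP => j /setDP[].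
have price j : \sum_i dist i j * u i j <=
    5 * t + (if j \in P then E (f j) else 0).
  have rt : radius <= t by rewrite /t ler_peMl ?ler1n// ltW.
  rewrite /u; case: (boolP (j \in P)) => jP; last first.
    by have [_ _] := vP j jP; lra.
  (* The detour from [f j] to [j] passes through the center [h (f j)]. *)
  have d_le i : dist i j <= dist i (f j) + 2 * t.
    have [_ _ cj cfj] := fP _ jP.
    have := dist_le i (f j) j.
    have := metric_triangle (cloc (f j)) (cloc (h (f j))) (cloc j).
    rewrite [mdist (cloc (f j)) (cloc (h (f j)))]metric_sym.
    by move: cj cfj; rewrite /cdist -/t; lra.
  apply: le_trans (_ : \sum_i (dist i (f j) * w i (f j) +
                               2 * t * w i (f j)) <= _).
    by apply: ler_sum => i _; rewrite -mulrDl ler_wpM2r ?w0// fQ.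
  by rewrite big_split/= -mulr_sumr w1 ?fQ//; have := wE _ (fQ _ jP); lra.
have cx0 : 0 <= \sum_i cost i * x i.
  by apply: sumr_ge0 => i _; rewrite mulr_ge0// cost_ge0.
apply: le_trans (_ : static_objective (fun i => 5 * p%:R * x i) u <= _).
  apply: ge_inf; first by case: (has_inf_static_values I).
  exists (fun i => 5 * p%:R * x i), u; split=> //; split=> //.
  - by move=> j; rewrite u1.
  - move=> i; apply/max_scenario_le; first by rewrite !mulr_ge0.
    by move=> S; exact: load.
  - by move=> i; rewrite !mulr_ge0.
rewrite /static_objective mulrDr; apply: lerD.
  rewrite mulr_sumr; apply: ler_sum => i _.
  rewrite mulrCA ler_wpM2r ?mulr_ge0 ?cost_ge0//.
  by rewrite ler_wpM2r// ler_nat.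
apply/max_scenario_le => [|S sS]; first by rewrite !mulr_ge0// ltW.
rewrite exchange_big/=.
apply: le_trans (_ : \sum_(j in S)
  (5 * t + (if j \in P then E (f j) else 0)) <= _).
  by apply: ler_sum => j _; exact: price.
rewrite big_split/=.
have -> : 81 * p%:R * z = 5 * t * k%:R + p%:R * z.
  by rewrite /t /radius; field; rewrite gt_eqF.
apply: lerD.
  rewrite sumr_const -[leLHS]mulr_natr; apply: ler_wpM2l; first exact: mulr_ge0.
  rewrite ler_nat.
  exact: sS.
rewrite -big_mkcondr/=.
rewrite (eq_bigl (mem (S :&: P))); last by move=> j; rewrite !inE.
apply: le_trans (by_fiber S E (fun a _ => E0 a)) _.
by rewrite ler_wpM2l.
Qed.
End Rounding.

(** * The exponent and the approximation ratio *)

Lemma growth_exponent (R : realType) (k : nat) : (3 <= k)%N ->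
  exists p : nat, [/\ (0 < p)%N, (k <= p ^ p)%N &
    p%:R <= 3 * (ln k%:R / ln (ln k%:R)) :> R].
Proof.
move=> k3; set t : R := ln k%:R; set u := ln t.
have t1 : 1 < t.
  rewrite -[1]expRK ltr_ln ?posrE ?expR_gt0 ?ltr0n//; last by lia.
  apply: lt_le_trans (_ : 3 <= _); last by rewrite ler_nat.
  (* [exp (-1) >= (1 - 1 / 6) ^ 6 > 1 / 3] *)
  rewrite -[1]opprK expRN -[ltRHS]invrK ltf_pV2 ?posrE ?expR_gt0//.
  have -> : -1 = 6%:R * - 6^-1 :> R by field.
  rewrite expRM_natl; apply: lt_le_trans (_ : (5 / 6) ^+ 6 <= _); first by lra.
  rewrite lerXn2r ?nnegrE ?expR_ge0//.
  by apply: le_trans (expR_ge1Dx _); lra.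
have t0 : 0 < t by apply: lt_trans t1.
have tE : expR u = t by rewrite lnK.
have u0 : 0 < u by rewrite /u ln_gt0.
have ut : u <= t by have := expR_ge1Dx u; rewrite tE; lra.
(* With this choice [ln p.+1 >= u / 2], so [p.+1 * ln p.+1 >= t]; the rounding up by one costs at
   most [t / u]. *)
pose p := Num.truncn (2 * t / u).
have r2 : 2 <= 2 * t / u by rewrite ler_pdivlMr//; lra.
exists p.+1; split => //.
- rewrite -(ler_nat R) -ler_ln ?posrE ?ltr0n ?expn_gt0//; last by lia.
  rewrite natrX lnXn ?ltr0n// -/t -[_ *+ _]mulr_natl.
  have pr : 2 * t / u <= p.+1%:R by apply/ltW/truncnS_gt.
  have lp : u / 2 <= ln p.+1%:R.
    rewrite -[leLHS]expRK ler_ln ?posrE ?expR_gt0//.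
    apply: le_trans pr; rewrite ler_pdivlMr//.
    (* With [s = expR (u / 2)], the bound [u / 2 <= s] gives [s * u <= 2 * s ^ 2 = 2 * t]. *)
    have := expR_ge1Dx (u / 2).
    have : expR (u / 2) * expR (u / 2) = t by rewrite -expRD -splitr.
    nra.
  apply: le_trans (_ : 2 * t / u * (u / 2) <= _).
    by rewrite le_eqVlt; apply/orP; left; apply/eqP; field; rewrite gt_eqF.
  by rewrite ler_pM// ?divr_ge0//; lra.
- rewrite -natr1 mulrA.
  have : p%:R <= 2 * t / u by rewrite truncn_le; lra.
  have : 1 <= t / u by rewrite ler_pdivlMr//; lra.
  by rewrite -!mulrA; lra.
Qed.

Theorem theorem2 (R : realType) :
  exists A : R, 0 < A /\
    forall I : instance R, (3 <= budget I)%N ->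
      static_opt I <=
        A * (ln (budget I)%:R / ln (ln (budget I)%:R)) * LP_opt I.
Proof.
(* [243 = 81 * 3], from the rounding and the exponent. *)
exists 243; split=> // I /(growth_exponent R)[p [p0 kp pL]].
have c0 : 0 < 81 * p%:R :> R by rewrite mulr_gt0 ?ltr0n.
have main : static_opt I <= 81 * p%:R * LP_opt I.
  rewrite -ler_pdivrMl//; apply: lb_le_inf; first by case: (has_inf_LP_values I).
  move=> _ [x [y [xy ->]]]; rewrite ler_pdivrMl//.
  (* Rounding needs [z > 0] while [m] may vanish; the slack added to [m] contributes exactly [e] in
     the end. *)
  apply/ler_addgt0Pr => e e0.
  pose m := max_scenario (fun S => \sum_i \sum_(j in S) dist i j * y S i j).
  pose z := m + e / (81 * p%:R).
  have z0 : 0 < z by rewrite ltr_wpDl ?max_scenario_ge0// divr_gt0.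
  apply: le_trans (_ : 81 * p%:R * (\sum_i cost i * x i + z) <= _).
    apply: static_rounding xy z0 _ _ p0 kp => S sS.
    apply: le_trans (_ : m <= _); last by rewrite lerDl divr_ge0// ltW.
    move: S sS; apply: (proj1 (max_scenario_le _ (max_scenario_ge0 _))).
    exact: lexx.
  by rewrite /z /LP_objective addrA [leLHS]mulrDr mulrCA divff ?mulr1// gt_eqF.
apply: (le_trans main); apply: ler_wpM2r; last by lra.
apply: lb_le_inf; first by case: (has_inf_LP_values I).
by move=> _ [x [y [xy ->]]]; exact: LP_objective_ge0.
Qed.
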